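(* Let $D$ be a noncommutative division ring finite-dimensional over its center $K$. Suppose that $A$ is an abelian maximal subgroup of $D^*$, and set $L=A\cup\{0\}$. Then $L$ is a maximal subfield of $D$, and $L^*/K^*$ is malnormal in $D^*/K^*$. Equivalently to the latter, $$L^*\cap xL^*x^{-1}=K^*\quad\text{for every }x\in D^*\setminus L^*.$$ In particular, $N_{D^*}(L^* )=L^*$.
   Context: For a division ring $R$, $R^*=R\setminus\{0\}$ is its multiplicative group. A maximal subgroup of a group $G$ is a proper subgroup not properly contained in any proper subgroup of $G$. A subgroup $H$ of a group $G$ is malnormal if $H\cap gHg^{-1}=1$ for every $g\in G\setminus H$. $N_{D^*}(L^* )$ denotes the normalizer of $L^*$ in $D^*$. *)

(* Defs.v *)
From HB Require Import structures.
From mathcomp Require Import all_boot all_order all_algebra all_field.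
From mathcomp Require Import boolp classical_sets.

Set Implicit Arguments.
Unset Strict Implicit.
Unset Printing Implicit Defensive.

Import GRing.Theory.
Local Open Scope classical_set_scope.

Section Subgroups.
Local Open Scope group_scope.
Variable G : groupType.
Implicit Types H B : set G.

Definition subgroup H : Prop := group_closed (mem H).

Definition abelian_subset H : Prop :=
  forall x y, H x -> H y -> commute x y.

Definition maximal_subgroup H : Prop :=
  [/\ subgroup H, H `<` setT
    & forall B, subgroup B -> B `<` setT -> ~ (H `<` B)].

(* g H g^-1; the library's x ^ g is g^-1 * (x * g), hence the explicit form. *)
Definition conj_set (g : G) H : set G := [set g * x * g^-1 | x in H].

Definition normalizer_set H : set G := [set g | conj_set g H = H].

Definition malnormal H : Prop :=
  subgroup H /\
  forall g, ~ H g -> H `&` conj_set g H = [set 1].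

End Subgroups.

Section QuotientGroup.
Local Open Scope group_scope.
Local Open Scope quotient_scope.

Record normalSubgroup (G : groupType) := NormalSubgroup {
  nsub_set :> set G;
  nsub_subgroup : subgroup nsub_set;
  nsub_conj : forall g x : G, nsub_set x -> nsub_set (g * x * g^-1)
}.

Variables (G : groupType) (N : normalSubgroup G).

Fact nsub1 : nsub_set N 1.
Proof. by case: (nsub_subgroup N) => /set_mem. Qed.

Fact nsubF x y : nsub_set N x -> nsub_set N y -> nsub_set N (x / y).
Proof.
by move=> Nx Ny; case: (nsub_subgroup N) => _ NF; apply/set_mem/NF; apply: mem_set.
Qed.

Fact nsubV x : nsub_set N x -> nsub_set N x^-1.
Proof. by move=> Nx; rewrite -[x^-1]mul1g; apply: nsubF => //; apply: nsub1. Qed.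

Fact nsubM x y : nsub_set N x -> nsub_set N y -> nsub_set N (x * y).
Proof. by move=> Nx Ny; rewrite -[y]invgK; apply/nsubF/nsubV. Qed.

Definition coset_rel (x y : G) : bool := `[< nsub_set N (x / y) >].

Fact coset_rel_refl : reflexive coset_rel.
Proof. by move=> x; apply/asboolP; rewrite mulgV; apply: nsub1. Qed.

Fact coset_rel_sym : symmetric coset_rel.
Proof.
by move=> x y; apply: asbool_equiv_eq; split=> /nsubV; rewrite invgF.
Qed.

Fact coset_rel_trans : transitive coset_rel.
Proof.
move=> y x z /asboolP Nxy /asboolP Nyz; apply/asboolP.
by have := nsubM Nxy Nyz; rewrite mulgA mulgVK.
Qed.

Canonical coset_equiv :=
  EquivRel coset_rel coset_rel_refl coset_rel_sym coset_rel_trans.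

Definition quotient_group := {eq_quot coset_equiv}.
HB.instance Definition _ := Choice.on quotient_group.
HB.instance Definition _ := EqQuotient.on quotient_group.

Definition quotient_map (x : G) : quotient_group := \pi_quotient_group x.

Fact quotient_mapP x y :
  quotient_map x = quotient_map y <-> nsub_set N (x / y).
Proof. by split=> [/eqmodP/asboolP|Nxy]//; apply/eqmodP/asboolP. Qed.

Fact quotient_mapK (u : quotient_group) : quotient_map (repr u) = u.
Proof. exact: reprK. Qed.

Definition quotient_one : quotient_group := quotient_map 1.
Definition quotient_inv (u : quotient_group) : quotient_group :=
  quotient_map (repr u)^-1.
Definition quotient_mul (u v : quotient_group) : quotient_group :=
  quotient_map (repr u * repr v).

Fact quotient_mul_map x y :
  quotient_mul (quotient_map x) (quotient_map y) = quotient_map (x * y).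
Proof.
apply/quotient_mapP.
set a := repr (quotient_map x); set b := repr (quotient_map y).
have Na : nsub_set N (a / x) by apply/quotient_mapP; apply: quotient_mapK.
have Nb : nsub_set N (b / y) by apply/quotient_mapP; apply: quotient_mapK.
have := nsubM (nsub_conj a Nb) Na.
by rewrite invgM !mulgA mulgVK.
Qed.

Fact quotient_inv_map x :
  quotient_inv (quotient_map x) = quotient_map x^-1.
Proof.
apply/quotient_mapP; rewrite invgK.
set a := repr (quotient_map x).
have /nsubV : nsub_set N (a / x) by apply/quotient_mapP; apply: quotient_mapK.
by move/(nsub_conj a^-1); rewrite invgF !invgK !mulgA mulgVK.
Qed.

Fact quotient_mulA : associative quotient_mul.
Proof.
move=> u v w; rewrite -(quotient_mapK u) -(quotient_mapK v) -(quotient_mapK w).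
by rewrite !quotient_mul_map mulgA.
Qed.

Fact quotient_mul1g : left_id quotient_one quotient_mul.
Proof. by move=> u; rewrite -(quotient_mapK u) quotient_mul_map mul1g. Qed.

Fact quotient_mulg1 : right_id quotient_one quotient_mul.
Proof. by move=> u; rewrite -(quotient_mapK u) quotient_mul_map mulg1. Qed.

Fact quotient_mulVg : left_inverse quotient_one quotient_inv quotient_mul.
Proof.
by move=> u; rewrite -(quotient_mapK u) quotient_inv_map quotient_mul_map mulVg.
Qed.

Fact quotient_mulgV : right_inverse quotient_one quotient_inv quotient_mul.
Proof.
by move=> u; rewrite -(quotient_mapK u) quotient_inv_map quotient_mul_map mulgV.
Qed.

HB.instance Definition _ := isGroup.Build quotient_group
  quotient_mulA quotient_mul1g quotient_mulg1 quotient_mulVg quotient_mulgV.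

End QuotientGroup.

(* The library's {unit R} is only available for finite rings. *)
Section UnitGroup.
Local Open Scope ring_scope.
Variable R : unitRingType.

Record unitGroup := UnitGroup {
  unit_val :> R;
  unit_valP : unit_val \is a GRing.unit
}.

HB.instance Definition _ := [isSub for unit_val].
HB.instance Definition _ := [Choice of unitGroup by <:].

Definition unit_one : unitGroup := UnitGroup (unitr1 R).
Fact unit_inv_subproof (u : unitGroup) : (val u)^-1 \is a GRing.unit.
Proof. by rewrite unitrV; exact: unit_valP. Qed.
Definition unit_inv (u : unitGroup) : unitGroup :=
  UnitGroup (unit_inv_subproof u).
Fact unit_mul_subproof (u v : unitGroup) : val u * val v \is a GRing.unit.
Proof. by rewrite unitrMl; exact: unit_valP. Qed.
Definition unit_mul (u v : unitGroup) : unitGroup :=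
  UnitGroup (unit_mul_subproof u v).

Fact unit_mulA : associative unit_mul.
Proof. by move=> u v w; apply: val_inj; exact: mulrA. Qed.
Fact unit_mul1g : left_id unit_one unit_mul.
Proof. by move=> u; apply: val_inj; exact: mul1r. Qed.
Fact unit_mulg1 : right_id unit_one unit_mul.
Proof. by move=> u; apply: val_inj; exact: mulr1. Qed.
Fact unit_mulVg : left_inverse unit_one unit_inv unit_mul.
Proof. by move=> u; apply: val_inj; apply: mulVr; exact: unit_valP. Qed.
Fact unit_mulgV : right_inverse unit_one unit_inv unit_mul.
Proof. by move=> u; apply: val_inj; apply: mulrV; exact: unit_valP. Qed.

HB.instance Definition _ := isGroup.Build unitGroup
  unit_mulA unit_mul1g unit_mulg1 unit_mulVg unit_mulgV.

(* S^*, as a subset of R^* *)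
Definition units_in (S : set R) : set unitGroup := [set u | S (val u)].

Definition adjoin_zero (A : set unitGroup) : set R := (val @` A) `|` [set 0].

Definition subfield (F : set R) : Prop :=
  divring_closed (mem F) /\ (forall x y, F x -> F y -> x * y = y * x).

Definition maximal_subfield (F : set R) : Prop :=
  subfield F /\ forall E, subfield E -> ~ (F `<` E).

End UnitGroup.

Section Center.
Local Open Scope ring_scope.
Variables (K : fieldType) (D : falgType K).

Definition center_set : set D := [set z | z \in 'Z({:D})%VS].

Fact center_setP (z : D) : center_set z <-> forall x, z * x = x * z.
Proof.
rewrite /center_set /=; split=> [/memv_capP[_ /centvP zC] x|zC].
  by rewrite zC ?memvf.
by apply/memv_capP; split; [exact: memvf | apply/centvP => x _; rewrite zC].
Qed.

Fact center_units_subgroup : subgroup (units_in center_set).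
Proof.
split=> [|u v /set_mem /center_setP uC /set_mem /center_setP vC];
  apply/mem_set/center_setP => x.
  by rewrite mul1r mulr1.
have vVC : (val v)^-1 * x = x * (val v)^-1.
  by apply/esym/commrV; rewrite /GRing.comm vC.
by rewrite /= -mulrA vVC mulrA uC -mulrA.
Qed.

Fact center_units_conj (g u : unitGroup D) :
  units_in center_set u -> units_in center_set (g * u * g^-1)%g.
Proof.
move=> /center_setP uC; have -> // : (g * u * g^-1)%g = u.
  apply: val_inj; rewrite /= -uC mulrK //; exact: unit_valP.
by apply/center_setP.
Qed.

Definition center_units : normalSubgroup (unitGroup D) :=
  NormalSubgroup center_units_subgroup center_units_conj.

End Center.

(* Main.v *)
(* By maximality the centralizer of every noncentral [a] in [A] is [A] itself,
   and such an [a] exists because otherwise [A] would be the centralizer of any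
   noncentral element. Hence [L] is the centralizer of [a] in [D], a maximal
   subfield. If a noncentral [u] lies in [A] and in [x A x^-1], comparing the
   centralizers of [u] and [x^-1 u x] shows that [x] normalizes [A]. The
   normalizer of [A] is [A] or [D^*], and the latter is excluded by the
   Cartan-Brauer-Hua argument. *)
Require Import Defs.
From mathcomp Require Import all_boot all_order all_algebra all_field.
From mathcomp Require Import boolp classical_sets.

Set Implicit Arguments.
Unset Strict Implicit.
Unset Printing Implicit Defensive.

Import GRing.Theory.
Local Open Scope classical_set_scope.
Local Open Scope ring_scope.

(** * Abelian maximal subgroups, centralizers and normalizers in an abstract group *)

Section Groups.
Local Open Scope group_scope.
Variable G : groupType.
Implicit Types (A H B : set G) (a g x y : G).

Lemma subgroupP H :
  subgroup H <-> H 1 /\ (forall x y, H x -> H y -> H (x / y)).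
Proof.
split=> [[/set_mem H1 HF]|[H1 HF]].
  by split=> // x y Hx Hy; apply/set_mem/HF; apply: mem_set.
by split=> [|x y /set_mem Hx /set_mem Hy]; apply/mem_set; [|exact: HF].
Qed.

Lemma subgroupV H x : subgroup H -> H x -> H x^-1.
Proof. by move=> /subgroupP[H1 HF] Hx; rewrite -div1g; apply: HF. Qed.

Lemma subgroupM H x y : subgroup H -> H x -> H y -> H (x * y).
Proof.
move=> sgH Hx /(subgroupV sgH) HVy; rewrite -[y]invgK.
by case/subgroupP: sgH => _; apply.
Qed.

Lemma maximal_subgroup_eq H B : maximal_subgroup H -> subgroup B ->
  H `<=` B -> B <> setT -> B = H.
Proof.
move=> [_ _ maxH] sgB HB BT; apply/seteqP; split=> //; apply: contrapT => BH.
apply: (maxH B) => //; split=> // TB; apply: BT.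
exact/seteqP.
Qed.

Lemma maximal_subgroup_neqT H : maximal_subgroup H -> H <> setT.
Proof. by move=> [_ HT _] eqT; move: HT; rewrite eqT => -[_]; apply. Qed.

Definition centralizer_set a : set G := [set x | commute a x].

Lemma centralizer_subgroup a : subgroup (centralizer_set a).
Proof.
apply/subgroupP; split=> [|x y cx cy]; first exact: commute1.
by apply/commuteM/commuteV.
Qed.

Lemma centralizer_maximal A a : maximal_subgroup A -> abelian_subset A ->
  A a -> centralizer_set a <> setT -> centralizer_set a = A.
Proof.
move=> maxA abelA Aa; apply: maximal_subgroup_eq => //.
  exact: centralizer_subgroup.
by move=> x; apply: abelA.
Qed.

(** If [A] were central, the centralizer of a noncentral [x] would be a proper subgroup containing
    [A], hence [A] itself. It contains [x], so [x] would be central after all. *)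
Lemma maximal_abelian_noncentral A : maximal_subgroup A -> abelian_subset A ->
  ~ (forall x y : G, commute x y) ->
  exists2 a, A a & centralizer_set a <> setT.
Proof.
move=> maxA abelA nabG; apply: contrapT => Acent.
have cA a x : A a -> commute a x.
  move=> Aa; suff : centralizer_set a x by [].
  suff -> : centralizer_set a = setT by [].
  by apply: contrapT => aT; apply: Acent; exists a.
apply: nabG => x y; apply: contrapT => nxy.
have cxT : centralizer_set x <> setT.
  by move=> cx; apply: nxy; suff : centralizer_set x y by []; rewrite cx.
have cxA : centralizer_set x = A.
  apply: maximal_subgroup_eq => //; first exact: centralizer_subgroup.
  by move=> a Aa; apply/commute_sym/cA.
by apply/nxy/cA; rewrite -cxA; apply: commute_refl.
Qed.

Lemma conj_setE g H : conj_set g H = [set x | H (g^-1 * x * g)].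
Proof.
apply/seteqP; split=> [_ [x Hx <-]|x Hx] /=.
  by rewrite -!mulgA mulVg mulg1 mulKg.
by exists (g^-1 * x * g) => //; rewrite !mulgA mulgV mul1g mulgK.
Qed.

Lemma normalizer_setP g H : normalizer_set H g <->
  forall x, H (g^-1 * x * g) <-> H x.
Proof.
rewrite /normalizer_set /= conj_setE; split=> [eqH x|eqH].
  by rewrite -{2}eqH.
by apply/seteqP; split=> x /eqH.
Qed.

Lemma normalizer_subgroup H : subgroup (normalizer_set H).
Proof.
apply/subgroupP; split=> [|x y /normalizer_setP Nx /normalizer_setP Ny].
  by apply/normalizer_setP => x; rewrite invg1 mul1g mulg1.
apply/normalizer_setP => z; rewrite invgF.
(* This element is chosen so that conjugating it by [y^-1] leaves [x^-1 * z * x], to which [Nx]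
   applies. *)
have := Ny (y / x * z * (x / y)).
by rewrite !mulgA mulVg mul1g mulgVK => eqz; rewrite -eqz -[H z]Nx.
Qed.

(* [A] is the centralizer of both [a] and its conjugate by [g]. *)
Lemma maximal_abelian_normalizer A a g : maximal_subgroup A ->
  abelian_subset A -> A a -> centralizer_set a <> setT -> A (g^-1 * a * g) ->
  normalizer_set A g.
Proof.
move=> maxA abelA Aa aT Aag; apply/normalizer_setP => x.
have cag y : commute a y <-> commute (g^-1 * a * g) (g^-1 * y * g).
  have conjE z : g^-1 * z * g = z ^ g by rewrite conjgE mulgA.
  by rewrite !conjE /commute -!conjMg; split=> [->|/conjg_inj].
have caA := centralizer_maximal maxA abelA Aa aT.
have cgA : centralizer_set (g^-1 * a * g) = A.
  (* The conjugate of [a] is noncentral: by [cag], if it commuted with everything, so would [a]. *)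
  apply: centralizer_maximal => // cgT; apply: aT; apply/seteqP; split=> // y _.
  apply/cag; suff : centralizer_set (g^-1 * a * g) (g^-1 * y * g) by [].
  by rewrite cgT.
by rewrite -{1}cgA -caA; exact: iff_sym (cag x).
Qed.

Lemma subgroup_sub_normalizer H : subgroup H -> H `<=` normalizer_set H.
Proof.
move=> sgH x Hx; apply/normalizer_setP => y; have HVx := subgroupV sgH Hx.
split=> [Hyx|Hy]; last by do 2!apply: subgroupM => //.
have -> : y = x * (x^-1 * y * x) * x^-1 by rewrite !mulgA mulgV mul1g mulgK.
by do 2!apply: subgroupM => //.
Qed.

End Groups.

(** * From the unit group to the division ring: the Cartan-Brauer-Hua argument and maximal
    subfields *)

Section DivisionRings.
Variable R : unitRingType.
Implicit Types (S : set R) (a b c x z : R).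

Lemma divring_closedP S : divring_closed (mem S) <->
  [/\ S 1, forall x y, S x -> S y -> S (x - y)
         & forall x y, S x -> S y -> S (x / y)].
Proof.
split=> [[/set_mem S1 SB SF]|[S1 SB SF]].
  by split=> // x y Sx Sy; apply/set_mem; [apply: SB|apply: SF]; apply: mem_set.
split=> [|x y /set_mem Sx /set_mem Sy|x y /set_mem Sx /set_mem Sy];
  apply/mem_set; [exact: S1|exact: SB|exact: SF].
Qed.

Lemma ring_centralizer_closed a :
  divring_closed (mem [set z | GRing.comm a z]).
Proof.
apply/divring_closedP; split=> [|x y ax ay|x y ax ay] /=.
- exact: commr1.
- exact: commrB.
- exact/commrM/commrV.
Qed.

(* If [x a x^-1 = b] and [(1 + x) a (1 + x)^-1 = c] then
   [(b - c) x = c - a], so [b != c] would force [x] into [S]. *)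
Lemma cartan_brauer_hua S a b c x :
    (forall z, z != 0 -> z \is a GRing.unit) ->
    divring_closed (mem S) -> S a -> S b -> S c -> ~ S x ->
    x * a = b * x -> (1 + x) * a = c * (1 + x) ->
  GRing.comm a x.
Proof.
move=> divR /divring_closedP[S1 SB SF] Sa Sb Sc nSx xa.
rewrite mulrDl mul1r mulrDr mulr1 xa => eqac.
have eqx : (b - c) * x = c - a.
  by rewrite mulrBl; apply/eqP; rewrite subr_eq addrAC -eqac addrC addKr.
(* When [b = c], [eqx] collapses to [c = a], and [x * a = b * x] becomes the commutation sought. *)
have [eqbc|] := eqVneq b c.
  move: eqx; rewrite eqbc subrr mul0r => /esym/eqP; rewrite subr_eq0 => /eqP eqca.
  by rewrite /GRing.comm xa eqbc eqca.
rewrite -subr_eq0 => /divR uBc; case: nSx.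
have SV z : S z -> S z^-1 by rewrite -[z^-1]mul1r; apply: SF.
by rewrite -[x](mulKr uBc) eqx -[c - a]invrK; apply/SF/SV/SB => //; apply/SV/SB.
Qed.

Lemma unit_commuteP (u v : unitGroup R) :
  commute u v <-> GRing.comm (val u) (val v).
Proof. by split=> [/(congr1 val)|?] //; apply: val_inj. Qed.

Lemma units_in_adjoin_zero (A : set (unitGroup R)) :
  units_in (adjoin_zero A) = A.
Proof.
apply/seteqP; split=> [u [[v Av /val_inj <-//]|/= u0]|u Au].
  by have := unit_valP u; rewrite u0 unitr0.
by left; exists u.
Qed.

Lemma adjoin_zero_centralizer (a : unitGroup R) :
    (forall z, z != 0 -> z \is a GRing.unit) ->
  adjoin_zero (centralizer_set a) = [set z | GRing.comm (val a) z].
Proof.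
move=> divR; apply/seteqP; split=> [_ [[u cu <-]|->]|z cz] /=.
- exact/unit_commuteP.
- exact: commr0.
have [->|/divR uz] := eqVneq z 0; first by right.
by left; exists (UnitGroup uz) => //; apply/unit_commuteP.
Qed.

Lemma unit_noncommutative :
    (forall z : R, z != 0 -> z \is a GRing.unit) ->
    ~ commutative (@GRing.mul R) ->
  ~ (forall u v : unitGroup R, commute u v).
Proof.
move=> divR ncR cG; apply: ncR => x y.
have [->|/divR ux] := eqVneq x 0; first by rewrite mul0r mulr0.
have [->|/divR uy] := eqVneq y 0; first by rewrite mul0r mulr0.
by have /unit_commuteP := cG (UnitGroup ux) (UnitGroup uy).
Qed.

(** If the normalizer were everything, a unit [x] outside [A] and also [1 + x] would conjugate [a]
    into [A]. The Cartan-Brauer-Hua identity then makes [x] commute with [a], which puts [x] in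
    [A]. *)
Lemma maximal_abelian_self_normalizing (A : set (unitGroup R)) :
    (forall z : R, z != 0 -> z \is a GRing.unit) ->
    ~ commutative (@GRing.mul R) ->
    maximal_subgroup A -> abelian_subset A ->
  normalizer_set A = A.
Proof.
move=> divR ncR maxA abelA; have [sgA _ _] := maxA.
have ncG := unit_noncommutative divR ncR.
have [a Aa aT] := maximal_abelian_noncentral maxA abelA ncG.
have caA := centralizer_maximal maxA abelA Aa aT.
apply: maximal_subgroup_eq => //; first exact: normalizer_subgroup.
  exact: subgroup_sub_normalizer.
move=> NT; apply: (maximal_subgroup_neqT maxA); apply/seteqP; split=> // x _.
apply: contrapT => nAx.
have conjA (y : unitGroup R) : A (y * a * y^-1)%g.
  have /normalizer_setP/(_ a)[_] : normalizer_set A y^-1%g by rewrite NT.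
  by rewrite invgK; apply.
have nax : ~ GRing.comm (val a) (val x).
  by move=> /unit_commuteP cax; apply: nAx; rewrite -caA.
(* Otherwise [x = -1], which commutes with [a]. *)
have ux1 : 1 + val x \is a GRing.unit.
  apply/divR/eqP => x1; apply: nax.
  have -> : val x = -1 by apply/eqP; rewrite -addr_eq0 addrC x1.
  by apply/commrN/commr1.
have LA (u : unitGroup R) : A u -> [set z | GRing.comm (val a) z] (val u).
  by rewrite -{1}caA => /unit_commuteP.
(* The division subring is the ring centralizer of [a], so [nax] also says that [x] lies outside
   it. *)
apply: (nax); apply: (cartan_brauer_hua divR (ring_centralizer_closed (val a))
    (LA _ Aa) (LA _ (conjA x)) (LA _ (conjA (UnitGroup ux1))) nax).
- by rewrite /= mulrVK // unit_valP.
- by rewrite /= mulrVK.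
Qed.

(** Adjoining zero to [A] gives the ring centralizer of [a], closed under the division ring
    operations. A commutative [E] containing it contains [a], so it centralizes [a] and cannot be
    larger. *)
Lemma maximal_subfield_adjoin_zero (A : set (unitGroup R)) :
    (forall z : R, z != 0 -> z \is a GRing.unit) ->
    ~ commutative (@GRing.mul R) ->
    maximal_subgroup A -> abelian_subset A ->
  maximal_subfield (adjoin_zero A).
Proof.
move=> divR ncR maxA abelA.
have ncG := unit_noncommutative divR ncR.
have [a Aa aT] := maximal_abelian_noncentral maxA abelA ncG.
have caA := centralizer_maximal maxA abelA Aa aT.
have eqL : adjoin_zero A = [set z | GRing.comm (val a) z].
  by rewrite -adjoin_zero_centralizer // caA.
split=> [|E [_ abE] [LE]].
  split=> [|_ _ [[u Au <-]|->] [[v Av <-]|->]]; rewrite ?mul0r ?mulr0 //.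
    by rewrite eqL; apply: ring_centralizer_closed.
  by have /unit_commuteP := abelA u v Au Av.
apply=> e Ee; rewrite eqL; apply: abE => //.
by apply: LE; left; exists a.
Qed.

End DivisionRings.

(** * Passage to the quotient, and the conclusion *)

(** Since [N] lies in [H], any representative decides whether a coset meets [H]. The intersection
    therefore lifts to that of [H] with its conjugate, which is [N] and maps to 1. *)
Lemma malnormal_quotient (G : groupType) (N : normalSubgroup G) (H : set G) :
    subgroup H -> N `<=` H ->
    (forall x, ~ H x -> H `&` conj_set x H = N) ->
  malnormal [set quotient_map N x | x in H].
Proof.
move=> sgH NH HN; have [H1 HF] := (subgroupP H).1 sgH.
have mulE (x y : G) :
    (quotient_map N x * quotient_map N y)%g = quotient_map N (x * y)%g.
  exact: quotient_mul_map.
have invE (x : G) : (quotient_map N x)^-1%g = quotient_map N x^-1%g.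
  exact: quotient_inv_map.
have mapH x : [set quotient_map N y | y in H] (quotient_map N x) -> H x.
  case=> y Hy /esym/quotient_mapP /NH Hxy.
  by rewrite -[x](mulgVK y); apply: subgroupM.
split.
  apply/subgroupP; split=> [|_ _ [x Hx <-] [y Hy <-]]; first by exists 1%g.
  by exists (x / y)%g; [exact: HF | rewrite invE mulE].
move=> u nHu; rewrite -(quotient_mapK u) in nHu *; set g := repr u in nHu *.
have nHg : ~ H g by move=> Hg; apply: nHu; exists g.
apply/seteqP; split=> [_ [[x Hx <-]]|_ ->].
  rewrite conj_setE /= invE (mulE g^-1%g) (mulE (g^-1 * x)%g) => /mapH Hxg.
  apply/quotient_mapP.
  by rewrite divg1 -(HN g nHg); split=> //; rewrite conj_setE.
split; first by exists 1%g.
by rewrite conj_setE /= mulg1 mulVg; exists 1%g.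
Qed.

Theorem proposition5p2 (K : fieldType) (D : falgType K)
    (divD : forall x : D, x != 0 -> x \is a GRing.unit)
    (centerD : 'Z({:D})%VS = 1%VS)
    (noncommD : ~ commutative (@GRing.mul D))
    (A : set (unitGroup D))
    (maxA : maximal_subgroup A)
    (abelA : abelian_subset A)
    (L : set D) (defL : L = adjoin_zero A) :
  let Ls := units_in L in
  let Ks := center_units D in
  [/\ maximal_subfield L,
      malnormal [set quotient_map Ks x | x in Ls],
      forall x : unitGroup D, ~ Ls x -> Ls `&` conj_set x Ls = Ks
    & normalizer_set Ls = Ls].
Proof.
move=> Ls Ks; have eqLs : Ls = A by rewrite /Ls defL units_in_adjoin_zero.
have [sgA _ _] := maxA.
have ncG := unit_noncommutative divD noncommD.
have NA := maximal_abelian_self_normalizing divD noncommD maxA abelA.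
(* Commuting with all units suffices to be central in [D], since 0 is the only nonunit. *)
have KsP (u : unitGroup D) : nsub_set Ks u <-> forall v, commute u v.
  split=> [/center_setP uC v|uC]; first exact/unit_commuteP/uC.
  apply/center_setP => x; have [->|/divD ux] := eqVneq x 0.
    by rewrite mul0r mulr0.
  by have /unit_commuteP := uC (UnitGroup ux).
have KA : nsub_set Ks `<=` A.
  have [a Aa aT] := maximal_abelian_noncentral maxA abelA ncG.
  rewrite -(centralizer_maximal maxA abelA Aa aT) => u /KsP uC.
  exact/commute_sym/uC.
have malA (x : unitGroup D) : ~ A x -> A `&` conj_set x A = Ks.
  move=> nAx; rewrite conj_setE; apply/seteqP; split=> [u [Au Aux]|u Ku].
    (* A noncentral [u] in the intersection makes [x] normalize [A], and [NA] then puts [x] in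
       [A]. *)
    apply: contrapT => nKu; apply: nAx; rewrite -NA.
    apply: maximal_abelian_normalizer Au _ Aux => // uT.
    by apply/nKu/KsP => v; suff : centralizer_set u v by []; rewrite uT.
  split; first exact: KA.
  by rewrite /= -mulgA ((KsP u).1 Ku) mulKg; apply: KA.
rewrite eqLs; split=> //.
  by rewrite defL; apply: maximal_subfield_adjoin_zero.
exact: malnormal_quotient.
Qed.
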